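(* Let $0<q<1$, let $\mathcal Q$ be the Mallows measure with parameter $q$ on the group $\mathfrak S^{\mathrm{bal}}$ of balanced permutations of $\mathbb Z$, let $X=\{0,1,2,\dots\}^{\mathbb Z}$ and let $\mathcal G=\bigotimes_{i\in\mathbb Z}G$ be the product measure on $X$, where $G$ is the geometric distribution $G(n)=(1-q)q^n$, $n=0,1,2,\dots$. Let $\psi:\mathfrak S^{\mathrm{bal}}\to X$ be the map $\psi(\sigma)=(r_i)_{i\in\mathbb Z}$, where $r_i=\#\{j>i:\sigma(j)<\sigma(i)\}$. Then $\psi$ provides an isomorphism of the measure space $(\mathfrak S^{\mathrm{bal}},\mathcal Q)$ onto the product measure space $(X,\mathcal G)$.
   Context: $\mathfrak S$ is the group of all bijections of $\mathbb Z$, with the topology of pointwise convergence (for each $i$, $\sigma_n(i)=\sigma(i)$ for all large $n$) and its Borel structure. $\sigma\in\mathfrak S$ is balanced if $\#\{j\ge 1:\sigma(j)\le 0\}=\#\{j\le 0:\sigma(j)\ge 1\}<\infty$. For balanced $\sigma$ all the counts $r_i$ are finite. For $i\in\mathbb Z$ let $\sigma_{i,i+1}$ be the transposition swapping $i$ and $i+1$. A measure $\mu$ is right $q$-exchangeable if for every $i\in\mathbb Z$ its pushforward under $\sigma\mapsto\sigma\sigma_{i,i+1}$ is equivalent to $\mu$ with Radon–Nikodým derivative $q^{\mathrm{sgn}(\sigma(i+1)-\sigma(i))}$ at $\sigma$; it is left $q$-exchangeable if for every $i$ its pushforward under $\sigma\mapsto\sigma_{i,i+1}\sigma$ is equivalent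 to $\mu$ with derivative $q^{\mathrm{sgn}(\sigma^{-1}(i+1)-\sigma^{-1}(i))}$. The Mallows measure $\mathcal Q$ is the unique (existing) Borel probability measure on $\mathfrak S^{\mathrm{bal}}$ that is both right and left $q$-exchangeable. ''Isomorphism of measure spaces'' is understood in the usual sense modulo null sets: $\psi$ is measurable, $\psi_*\mathcal Q=\mathcal G$, and $\psi$ restricts to a bimeasurable bijection between measurable subsets of full measure. *)

(* Defs.v *)
From HB Require Import structures.
From mathcomp Require Import all_boot all_order all_algebra finmap.
From mathcomp Require Import all_classical all_reals all_analysis.
From mathcomp Require Import zify.

Set Implicit Arguments.
Unset Strict Implicit.
Unset Printing Implicit Defensive.

Import Order.TTheory GRing.Theory Num.Theory.

Local Open Scope classical_set_scope.
Local Open Scope ring_scope.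

(* As a [set_type] over [{ptws _ -> _}], the type carries the topology of
   pointwise convergence induced from the functions into discrete Z. *)
Definition perm_int : Type :=
  [set f : {ptws int -> discrete_topology int} | bijective f].
HB.instance Definition _ := Topological.on perm_int.

Definition perm_fun (s : perm_int) : int -> int := set_val s.
Coercion perm_fun : perm_int >-> Funclass.

Lemma perm_fun_bij (s : perm_int) : bijective s.
Proof. exact: set_mem (valP s). Qed.

Lemma perm_funP (s t : perm_int) : s =1 t -> s = t.
Proof. by move=> st; apply: val_inj; apply/funext => j; exact: st. Qed.

Definition mk_perm (f : int -> int) (bf : bijective f) : perm_int :=
  exist _ (f : {ptws int -> discrete_topology int}) (mem_set bf).

Lemma perm_inv_subproof (s : perm_int) :
  exists g : int -> int, cancel s g /\ cancel g s.
Proof. by case: (perm_fun_bij s) => g sg gs; exists g. Qed.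

Definition perm_inv_fun (s : perm_int) : int -> int :=
  sval (cid (perm_inv_subproof s)).

Lemma perm_invK (s : perm_int) : cancel s (perm_inv_fun s).
Proof. by rewrite /perm_inv_fun; case: cid => g []. Qed.

Lemma perm_invKV (s : perm_int) : cancel (perm_inv_fun s) s.
Proof. by rewrite /perm_inv_fun; case: cid => g []. Qed.

Definition perm_inv (s : perm_int) : perm_int :=
  mk_perm (Bijective (perm_invKV s) (perm_invK s)).

Definition perm_comp (s t : perm_int) : perm_int :=
  mk_perm (bij_comp (perm_fun_bij s) (perm_fun_bij t)).

Definition adj_transp_fun (i : int) : int -> int :=
  fun j => if j == i then i + 1 else if j == i + 1 then i else j.

Lemma adj_transp_funK i : involutive (adj_transp_fun i).
Proof.
by move=> j; rewrite /adj_transp_fun /=; repeat case: ifPn => /=; lia.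
Qed.

Definition adj_transp (i : int) : perm_int :=
  mk_perm (inv_bij (adj_transp_funK i)).

Definition up_crossings (s : int -> int) : set int :=
  [set j | (1 <= j) && (s j <= 0)].
Definition down_crossings (s : int -> int) : set int :=
  [set j | (j <= 0) && (1 <= s j)].

Definition balanced (s : perm_int) : Prop :=
  finite_set (up_crossings s) /\ (up_crossings s #= down_crossings s)%card.

Lemma balancedP (s : perm_int) : balanced s <->
  exists n, (up_crossings s #= `I_n)%card /\ (down_crossings s #= `I_n)%card.
Proof.
split=> [[/finite_setP[n un] ud]|[n [un dn]]].
  exists n; split => //.
  by apply: card_eq_trans un; rewrite card_eq_sym.
split; first by apply/finite_setP; exists n.
by apply: card_eq_trans un _; rewrite card_eq_sym.
Qed.

Lemma balanced_inv (s : perm_int) : balanced s -> balanced (perm_inv s).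
Proof.
move=> /balancedP[n [un dn]]; apply/balancedP; exists n.
have sI := can_inj (perm_invK s).
have im (A : set int) : ((s : int -> int) @` A #= A)%card.
  by apply: inj_card_eq => x y _ _; exact: sI.
have gE : (perm_inv s : int -> int) = perm_inv_fun s by [].
have uE : up_crossings (perm_inv s) = (s : int -> int) @` down_crossings s.
  rewrite gE; apply/seteqP; split=> j /=; rewrite /up_crossings /down_crossings /=.
    move=> /andP[j1 sj]; exists (perm_inv_fun s j); last exact: perm_invKV.
    by rewrite perm_invKV sj.
  by move=> [k /andP[k0 sk] <-]; rewrite perm_invK sk.
have dE : down_crossings (perm_inv s) = (s : int -> int) @` up_crossings s.
  rewrite gE; apply/seteqP; split=> j /=; rewrite /up_crossings /down_crossings /=.
    move=> /andP[j1 sj]; exists (perm_inv_fun s j); last exact: perm_invKV.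
    by rewrite perm_invKV sj j1.
  by move=> [k /andP[k0 sk] <-]; rewrite perm_invK sk k0.
by rewrite uE dE; split; [exact: card_eq_trans (im _) dn|exact: card_eq_trans (im _) un].
Qed.

Lemma card_setD1_II (A : set int) (x : int) n : A x ->
  (A #= `I_n.+1)%card <-> (A `\ x #= `I_n)%card.
Proof.
move=> Ax; split=> [An1|An]; last by apply/eq_cardSP; exists x.
have /finite_setP[m Am] : finite_set (A `\ x).
  by apply: finite_setD; apply/finite_setP; exists n.+1.
have Am1 : (A #= `I_m.+1)%card by apply/eq_cardSP; exists x.
have /card_eq_II[<-//] : (`I_m.+1 #= `I_n.+1)%card.
by apply: card_eq_trans An1; rewrite card_eq_sym.
Qed.

Lemma balanced_compr (s : perm_int) i :
  balanced s -> balanced (perm_comp s (adj_transp i)).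
Proof.
move=> /balancedP[n [un dn]]; apply/balancedP.
set t := adj_transp_fun i.
have -> : (perm_comp s (adj_transp i) : int -> int) = s \o t by [].
have tK : involutive t := adj_transp_funK i.
have im (A : set int) : (t @` A #= A)%card.
  by apply: inj_card_eq => x y _ _; exact: (inv_inj tK).
have [i0|i0] := eqVneq i 0; last first.
  have t1 j : (1 <= t j) = (1 <= j).
    by rewrite /t /adj_transp_fun /=; repeat case: ifPn => /=; lia.
  have t0 j : (t j <= 0) = (j <= 0).
    by rewrite /t /adj_transp_fun /=; repeat case: ifPn => /=; lia.
  have uE : up_crossings (s \o t) = t @` up_crossings s.
    apply/seteqP; split=> j /=; rewrite /up_crossings /=.
      by move=> jP; exists (t j); [rewrite t1|exact: tK].
    by move=> [k kP <-]; rewrite t1 tK.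
  have dE : down_crossings (s \o t) = t @` down_crossings s.
    apply/seteqP; split=> j /=; rewrite /down_crossings /=.
      by move=> jP; exists (t j); [rewrite t0|exact: tK].
    by move=> [k kP <-]; rewrite t0 tK.
  by exists n; rewrite uE dE; split; apply: card_eq_trans (im _) _.
have tE j : t j = if j == 0 then 1 else if j == 1 then 0 else j.
  by rewrite /t /adj_transp_fun /= i0 add0r.
have uE j : j != 1 -> up_crossings (s \o t) j = up_crossings s j.
  rewrite /up_crossings /= tE => /negPf ->.
  by have [->|] := eqVneq j 0.
have dE j : j != 0 -> down_crossings (s \o t) j = down_crossings s j.
  rewrite /down_crossings /= tE => /negPf ->.
  by have [->|] := eqVneq j 1.
have u1 : up_crossings (s \o t) 1 = (s 0 <= 0) by rewrite /up_crossings /= tE.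
have d0 : down_crossings (s \o t) 0 = (1 <= s 1) by rewrite /down_crossings /= tE.
have u1' : up_crossings s 1 = (s 1 <= 0) by [].
have d0' : down_crossings s 0 = (1 <= s 0) by [].
have uD : up_crossings (s \o t) `\ 1 = up_crossings s `\ 1.
  apply/seteqP; split=> j [uj j1]; split=> //; first by rewrite -uE //; exact/eqP.
  by rewrite uE //; exact/eqP.
have dD : down_crossings (s \o t) `\ 0 = down_crossings s `\ 0.
  apply/seteqP; split=> j [dj j0]; split=> //; first by rewrite -dE //; exact/eqP.
  by rewrite dE //; exact/eqP.
have D1 (A : set int) x : ~ A x -> A `\ x = A.
  move=> nAx; apply/seteqP; split=> y; first by case.
  by move=> Ay; split=> // yx; apply: nAx; rewrite -yx.
have gt0 (A : set int) x : (A #= `I_n)%card -> A x -> n = n.-1.+1.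
  case: n {un dn} => // + Ax.
  by rewrite II0 card_eq0 => /eqP A0; rewrite A0 in Ax.
have [s0|s0] := lerP (s 0) 0; have [s1|s1] := lerP (s 1) 0.
- have U1 : up_crossings s 1 by rewrite u1'.
  have V1 : up_crossings (s \o t) 1 by rewrite u1.
  have D0 : ~ down_crossings s 0 by rewrite d0'; lia.
  have E0 : ~ down_crossings (s \o t) 0 by rewrite d0; lia.
  exists n; rewrite -(D1 _ _ E0) dD (D1 _ _ D0); split=> //.
  have nE := gt0 _ _ un U1; rewrite nE in un *.
  by apply/(card_setD1_II _ V1); rewrite uD; apply/card_setD1_II.
- have U1 : ~ up_crossings s 1 by rewrite u1'; lia.
  have V1 : up_crossings (s \o t) 1 by rewrite u1.
  have D0 : ~ down_crossings s 0 by rewrite d0'; lia.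
  have E0 : down_crossings (s \o t) 0 by rewrite d0; lia.
  exists n.+1; split.
    by apply/(card_setD1_II _ V1); rewrite uD (D1 _ _ U1).
  by apply/(card_setD1_II _ E0); rewrite dD (D1 _ _ D0).
- have U1 : up_crossings s 1 by rewrite u1'.
  have V1 : ~ up_crossings (s \o t) 1 by rewrite u1; lia.
  have D0 : down_crossings s 0 by rewrite d0'; lia.
  have E0 : ~ down_crossings (s \o t) 0 by rewrite d0; lia.
  exists n.-1; rewrite -(D1 _ _ V1) -(D1 _ _ E0) uD dD.
  by split; apply/card_setD1_II => //; rewrite -(gt0 _ _ un U1).
- have U1 : ~ up_crossings s 1 by rewrite u1'; lia.
  have V1 : ~ up_crossings (s \o t) 1 by rewrite u1; lia.
  have D0 : down_crossings s 0 by rewrite d0'; lia.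
  have E0 : down_crossings (s \o t) 0 by rewrite d0; lia.
  exists n; rewrite -(D1 _ _ V1) uD (D1 _ _ U1); split=> //.
  have nE := gt0 _ _ dn D0; rewrite nE in dn *.
  by apply/(card_setD1_II _ E0); rewrite dD; apply/card_setD1_II.
Qed.

Lemma balanced_compl (s : perm_int) i :
  balanced s -> balanced (perm_comp (adj_transp i) s).
Proof.
move=> bs; suff -> : perm_comp (adj_transp i) s =
    perm_inv (perm_comp (perm_inv s) (adj_transp i)).
  exact/balanced_inv/balanced_compr/balanced_inv.
have sI (u v : perm_int) : cancel u v -> v = perm_inv u.
  move=> uv; apply: perm_funP => j; rewrite -{1}(perm_invKV u j).
  exact: uv.
apply: sI => j.
change (adj_transp_fun i (s (perm_inv_fun s (adj_transp_fun i j))) = j).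
by rewrite perm_invKV adj_transp_funK.
Qed.

Definition bal_perm : Type := [set s : perm_int | balanced s].
HB.instance Definition _ := Topological.on bal_perm.

Definition bal_perm_val (s : bal_perm) : perm_int := set_val s.
Coercion bal_perm_val : bal_perm >-> perm_int.

Lemma bal_permP (s : bal_perm) : balanced s.
Proof. exact: set_mem (valP s). Qed.

Definition mk_bal_perm (s : perm_int) (bs : balanced s) : bal_perm :=
  exist _ s (mem_set bs).

Lemma balanced_id : balanced (mk_perm (@Bijective int int id id (fun=> erefl) (fun=> erefl))).
Proof.
apply/balancedP; exists 0%N; rewrite II0 !card_eq0; split; apply/eqP.
  by rewrite -subset0 => j; change ((1 <= j) && (j <= 0) -> False); lia.
by rewrite -subset0 => j; change ((j <= 0) && (1 <= j) -> False); lia.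
Qed.

HB.instance Definition _ := isPointed.Build bal_perm (mk_bal_perm balanced_id).

(* [s |-> s o sigma_{i,i+1}] and [s |-> sigma_{i,i+1} o s] *)
Definition mulr_transp (i : int) (s : bal_perm) : bal_perm :=
  mk_bal_perm (balanced_compr i (bal_permP s)).
Definition mull_transp (i : int) (s : bal_perm) : bal_perm :=
  mk_bal_perm (balanced_compl i (bal_permP s)).

HB.instance Definition _ :=
  Measurable.copy bal_perm (g_sigma_algebraType (@open bal_perm)).

(* [nu] and [mu] have the same null sets, and d nu / d mu = [f]. *)
Definition equivalent_with_density d (T : measurableType d) (R : realType)
    (nu mu : set T -> \bar R) (f : T -> R) : Prop :=
  [/\ nu `<< mu, mu `<< nu, measurable_fun [set: T] f &
      forall A, measurable A -> nu A = (\int[mu]_(x in A) (f x)%:E)%E].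

Section mallows.
Context (R : realType) (q : R).
Implicit Types mu : {measure set bal_perm -> \bar R}.

Definition right_q_exchangeable mu : Prop := forall i : int,
  equivalent_with_density (pushforward mu (mulr_transp i)) mu
    (fun s : bal_perm => q ^ Num.sg (s (i + 1) - s i)).

Definition left_q_exchangeable mu : Prop := forall i : int,
  equivalent_with_density (pushforward mu (mull_transp i)) mu
    (fun s : bal_perm => q ^ Num.sg (perm_inv s (i + 1) - perm_inv s i)).

Definition is_mallows (Q : probability bal_perm R) : Prop :=
  right_q_exchangeable Q /\ left_q_exchangeable Q.

End mallows.

Section product_space.
Context d (T : measurableType d).

Definition cylinders1 : set (set (int -> T)) :=
  \bigcup_(i in [set: int])
    preimage_set_system [set: int -> T] (fun x => x i) measurable.

Definition int_prod : Type := int -> T.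
HB.instance Definition _ :=
  Measurable.copy int_prod (g_sigma_algebraType cylinders1).

(* The values on finite cylinders determine the product measure, since they
   form a pi-system generating the product sigma-algebra. *)
Definition is_product_measure (R : realType) (P : int -> probability T R)
    (G : probability int_prod R) : Prop :=
  forall (J : {fset int}) (B : int -> set T), (forall i, measurable (B i)) ->
    G [set x : int_prod | forall i, i \in J -> B i (x i)] =
    (\prod_(i <- J) P i (B i))%E.

End product_space.

Section geometric_distribution.
Context (R : realType).

(* Outside [0 < q < 1] the value is the junk Dirac mass at 0, so that
   [geometric_prob q] is a probability for every [q]. *)
Definition geometric_prob (q : R) : set nat -> \bar R := fun U =>
  if 0 < q < 1 then (\esum_(k in U) ((1 - q) * q ^+ k)%:E)%E else \d_0%N U.

Variable q : R.
Local Open Scope ereal_scope.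

Let pmf_ge0 : (0 < q < 1)%R -> forall k, 0 <= ((1 - q) * q ^+ k)%:E.
Proof.
move=> /andP[q0 q1] k.
by rewrite lee_fin mulr_ge0 ?subr_ge0 ?ltW// exprn_gt0.
Qed.

Let geometric0 : geometric_prob q set0 = 0.
Proof. by rewrite /geometric_prob measure0; case: ifPn => //; rewrite esum_set0. Qed.

Let geometric_ge0 U : 0 <= geometric_prob q U.
Proof.
by rewrite /geometric_prob; case: ifPn => // q01; apply: esum_ge0 => k _; exact: pmf_ge0.
Qed.

Let geometric_sigma_additive : semi_sigma_additive (geometric_prob q).
Proof.
move=> F mF tF mUF; rewrite /geometric_prob; case: ifPn => q01; last first.
  exact: measure_semi_sigma_additive.
apply: cvg_toP.
  apply: ereal_nondecreasing_is_cvgn => a b ab.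
  apply: lee_sum_nneg_natr => // n _ _.
  by apply: esum_ge0 => k _; exact: pmf_ge0.
by rewrite nneseries_sum_bigcup// => i; exact: pmf_ge0.
Qed.

HB.instance Definition _ := isMeasure.Build _ _ _ (geometric_prob q)
  geometric0 geometric_ge0 geometric_sigma_additive.

Let geometric_setT : geometric_prob q [set: nat] = 1.
Proof.
rewrite /geometric_prob; case: ifPn => [q01|_]; last by rewrite probability_setT.
rewrite -nneseries_esumT; last by move=> *; exact: pmf_ge0.
have /andP[q0 q1] := q01.
apply/cvg_lim => //.
have -> : (fun n => \sum_(0 <= i < n | xpredT i) ((1 - q) * q ^+ i)%:E) =
    EFin \o series (geometric (1 - q) q)%R.
  by apply/funext => n /=; rewrite /series /= sumEFin.
have -> : 1 = ((1 - q) * (1 - q)^-1)%:E by rewrite mulfV// subr_eq0 gt_eqF.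
apply: cvg_EFin; first by near=> n.
by apply: cvg_geometric_series; rewrite gtr0_norm.
Unshelve. all: by end_near. Qed.

HB.instance Definition _ :=
  @Measure_isProbability.Build _ _ R (geometric_prob q) geometric_setT.

End geometric_distribution.

Definition inversions_at (s : int -> int) (i : int) : set int :=
  [set j | (i < j) && (s j < s i)].

(* Hence [fset_set] below never returns its default value. *)
Lemma finite_inversions_at (s : perm_int) i :
  balanced s -> finite_set (inversions_at s i).
Proof.
move=> [fu _].
have fitv (a b : int) : finite_set [set j : int | a < j <= b].
  apply: (sub_finite_set _ (finite_image (fun k : nat => a + k%:Z) (finite_II `|b - a|.+1))).
  by move=> j /= jab; exists `|j - a|%N; lia.
pose C := (perm_inv_fun s) @` [set j : int | 0 < j <= s i].
apply: (sub_finite_set (B := up_crossings s `|` [set j : int | i < j <= 0] `|` C)).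
  move=> j /= /andP[ij sji].
  have [s0|s0] := lerP (s j) 0; last first.
    by right; exists (s j); [rewrite /=; lia|exact: perm_invK].
  left; have [j0|j0] := lerP j 0; [right|left]; rewrite /up_crossings /=; lia.
rewrite !finite_setU; split; [split|]; [exact: fu|exact: (fitv i 0)|].
exact/finite_image/fitv.
Qed.

Definition inv_count (s : int -> int) (i : int) : nat :=
  #|` fset_set (inversions_at s i)|%fset.

Definition inv_count_map (s : bal_perm) : int_prod nat := fun i => inv_count s i.

(* Isomorphism modulo null sets: [A] and [B] are the sets of full measure
   between which [f] is a bimeasurable bijection. *)
Definition measure_isomorphism d1 d2 (T1 : measurableType d1)
    (T2 : measurableType d2) (R : realType) (mu : {measure set T1 -> \bar R})
    (nu : {measure set T2 -> \bar R}) (f : T1 -> T2) : Prop :=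
  [/\ measurable_fun [set: T1] f,
      (forall B, measurable B -> pushforward mu f B = nu B) &
      exists A B, [/\ measurable A /\ mu (~` A) = 0,
                      measurable B /\ nu (~` B) = 0,
                      set_bij A B f,
                      (forall C, measurable C -> C `<=` A -> measurable (f @` C)) &
                      (forall D, measurable D -> D `<=` B ->
                        measurable (A `&` f @^-1` D))]].

(* Main.v *)
Require Import Defs.
From mathcomp Require Import all_boot all_order all_algebra finmap.
From mathcomp Require Import all_classical all_reals all_analysis.
From mathcomp Require Import zify.

(** Two facts carry the proof: the numbers [r_i] are independent geometric
    variables, and a balanced permutation is recovered from them by an explicit
    measurable formula.

    Independence. Fix [i]. Below, [sigma(j)] is called next above [sigma(i)] when
    [j > i], [sigma(j) > sigma(i)] and no value taken to the right of [i] lies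
    strictly between them.
    Composing [sigma] on the right with the transposition [(i j)] for this [j]
    turns [r_i] into [r_i + 1] and leaves every other [r_l] unchanged, since the
    other positions to the right of [i] compare in the same way with [sigma(i)] and
    [sigma(j)], and those to the left of [i] see the same values. This transposition
    multiplies the measure by exactly [q] ([measure_mulr_swap]), because
    [(i j)] is a product of adjacent transpositions whose densities cancel in
    pairs except for one factor. Such a [j] always exists, and [r_i >= 1] exactly
    when a next value below exists, so summing over [j] gives
    [Q(r_i = k + 1, D) = q Q(r_i = k, D)] for every event [D] that depends only
    on the other coordinates. Summation over [k] gives
    [Q(r_i = k, D) = (1 - q) q^k Q(D)] ([inv_count_geometric]), hence the product
    formula on finite cylinders, and these determine a probability on [X].

    Inversion. For [j > i] let [c] be the number of [l >= j] with
    [sigma(l) < sigma(i)]; then [sigma(j) < sigma(i)] if and only if [r_j < c].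
    Starting from [c = r_i] at [j = i + 1] this decides one comparison after
    another, so the code [r] determines all inversions
    ([inv_count_smaller_beyond]), in particular the number [l_i] of [j < i] with
    [sigma(j) > sigma(i)]. Balance means that the number of [j > a] with
    [sigma(j) <= b] minus the number of [j <= a] with [sigma(j) > b] vanishes
    at [a = b = 0]; since it drops by one when [a] grows and rises by one when [b]
    grows, it equals [b - a] everywhere, and [b = sigma(i) - 1], [a = i] gives
    [sigma(i) = i + r_i - l_i] ([balanced_displacement]). Thus [psi] is injective
    on all balanced permutations, its range is cut out by countably many
    conditions on the coordinates, and its inverse is measurable on the range:
    the sets of full measure are the whole space of balanced permutations and the
    range of [psi]. *)

Set Implicit Arguments.
Unset Strict Implicit.
Unset Printing Implicit Defensive.

Import Order.TTheory GRing.Theory Num.Theory.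

Local Open Scope classical_set_scope.
Local Open Scope ring_scope.

(** * Events given by countably many conditions *)

Lemma fset_set_infinite (I : choiceType) (A : set I) :
  ~ finite_set A -> fset_set A = fset0.
Proof. by rewrite /fset_set; case: pselect. Qed.

Section measurable_conditions.
Context d (T : measurableType d).

Lemma measurable_cond_exists (I : countType) (P : I -> T -> Prop) :
  (forall i, measurable [set x | P i x]) ->
  measurable [set x | exists i, P i x].
Proof.
move=> mP; have -> : [set x | exists i, P i x] = \bigcup_i [set x | P i x].
  by apply/seteqP; split=> [x [i Px]|x [i _ Px]]; exists i.
exact: countable_bigcupT_measurable.
Qed.

Lemma measurable_cond_not (P : T -> Prop) :
  measurable [set x | P x] -> measurable [set x | ~ P x].
Proof. exact: measurableC. Qed.

Lemma measurable_cond_forall (I : countType) (P : I -> T -> Prop) :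
  (forall i, measurable [set x | P i x]) ->
  measurable [set x | forall i, P i x].
Proof.
move=> mP; have -> : [set x | forall i, P i x] = [set x | ~ exists i, ~ P i x].
  apply/seteqP; split=> [x Px [i nP]|x /= Px i]; first exact: nP (Px i).
  by have [//|nP] := pselect (P i x); exfalso; apply: Px; exists i.
by apply/measurable_cond_not/measurable_cond_exists => i; exact: measurable_cond_not.
Qed.

Lemma measurable_cond_and (P P' : T -> Prop) :
  measurable [set x | P x] -> measurable [set x | P' x] ->
  measurable [set x | P x /\ P' x].
Proof. exact: measurableI. Qed.

Lemma measurable_cond_const (P : Prop) : measurable [set _ : T | P].
Proof.
have [p|p] := pselect P.
  have -> : [set _ : T | P] = setT by apply/seteqP; split=> x.
  exact: measurableT.
have -> : [set _ : T | P] = set0 by apply/seteqP; split=> x.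
exact: measurable0.
Qed.

Lemma measurable_cond_iff (P P' : T -> Prop) :
  measurable [set x | P x] -> measurable [set x | P' x] ->
  measurable [set x | P x <-> P' x].
Proof.
move=> mP mP'; have -> : [set x | P x <-> P' x] =
    ~` ([set x | P x /\ ~ P' x] `|` [set x | ~ P x /\ P' x]).
  apply/seteqP; split=> x /=; first by tauto.
  by move=> H; have [p|p] := pselect (P x); have [p'|p'] := pselect (P' x); tauto.
by apply: measurableC; apply: measurableU; apply: measurable_cond_and => //;
  exact: measurable_cond_not.
Qed.

(** For a countable codomain this is measurability with respect to the discrete
    sigma-algebra. *)
Definition measurable_fibers (C : Type) (f : T -> C) :=
  forall v, measurable [set x | f x = v].

Lemma measurable_fibers_pred (C : countType) (f : T -> C) (P : C -> Prop) :
  measurable_fibers f -> measurable [set x | P (f x)].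
Proof.
move=> mf; have -> : [set x | P (f x)] = [set x | exists v, f x = v /\ P v].
  apply/seteqP; split=> [x Px|x [v [<-]]//]; by exists (f x).
by apply: measurable_cond_exists => v; apply: measurable_cond_and => //;
  exact: measurable_cond_const.
Qed.

Lemma measurable_fibers_pred2 (C C' : countType) (f : T -> C) (g : T -> C')
    (P : C -> C' -> Prop) : measurable_fibers f -> measurable_fibers g ->
  measurable [set x | P (f x) (g x)].
Proof.
move=> mf mg; have -> : [set x | P (f x) (g x)] =
    [set x | exists v, f x = v /\ P v (g x)].
  by apply/seteqP; split=> [x Px|x [v [<-]]//]; exists (f x).
apply: measurable_cond_exists => v; apply: measurable_cond_and; first exact: mf.
exact: measurable_fibers_pred.
Qed.

Lemma measurable_fibers_comp2 (C C' : countType) (C'' : Type)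
    (f : T -> C) (g : T -> C') (h : C -> C' -> C'') :
  measurable_fibers f -> measurable_fibers g ->
  measurable_fibers (fun x => h (f x) (g x)).
Proof.
by move=> mf mg v; exact: (measurable_fibers_pred2 (fun a b => h a b = v)).
Qed.

(** A finite subset of a countable type has only countably many possible values,
    so an event about a finite random set is a countable union over them. *)
Section counting.
Context (I : countType) (E : I -> T -> Prop).
Hypothesis mE : forall i, measurable [set x | E i x].

Lemma measurable_finite_set : measurable [set x | finite_set [set i | E i x]].
Proof.
have -> : [set x | finite_set [set i | E i x]] =
    [set x | exists S : {fset I}, forall i, E i x <-> i \in S].
  apply/seteqP; split=> x /=.
    move=> /finite_fsetP[S SE]; exists S => i.
    by split=> [Ei|iS]; [have : [set` S] i by rewrite -SE|
                         have : [set` S] i := iS; rewrite -SE].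
  move=> [S SE]; apply/finite_fsetP; exists S.
  by apply/seteqP; split=> i /SE.
apply: measurable_cond_exists => S; apply: measurable_cond_forall => i.
by apply: measurable_cond_iff => //; exact: measurable_cond_const.
Qed.

Lemma measurable_card_set :
  measurable_fibers (fun x => #|` fset_set [set i | E i x]|%fset).
Proof.
move=> k; have -> : [set x | #|` fset_set [set i | E i x]|%fset = k] =
    [set x | exists S : {fset I}, #|` S|%fset = k /\
       (forall i, E i x <-> i \in S)] `|`
    [set x | ~ finite_set [set i | E i x] /\ k = 0%N].
  apply/seteqP; split=> x /=.
    have [fE|nE] := pselect (finite_set [set i | E i x]) => Ek.
      left; exists (fset_set [set i | E i x]); split=> // i.
      rewrite in_fset_set//; split; first exact: mem_set.
      exact: set_mem.
    by right; split=> //; rewrite -Ek fset_set_infinite.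
  move=> [[S [Sk SE]]|[nE ->]].
    rewrite -Sk; congr (#|` _|%fset); rewrite -[RHS]set_fsetK; congr fset_set.
    by apply/seteqP; split=> i /SE.
  by rewrite fset_set_infinite.
apply: measurableU.
  apply: measurable_cond_exists => S; apply: measurable_cond_and; first exact: measurable_cond_const.
  apply: measurable_cond_forall => i.
  by apply: measurable_cond_iff => //; exact: measurable_cond_const.
apply: measurable_cond_and; last exact: measurable_cond_const.
exact: measurable_cond_not measurable_finite_set.
Qed.

End counting.
End measurable_conditions.

(** * The Borel structure of the balanced permutations *)

Lemma coord_open (i v : int) : open [set s : bal_perm | s i = v].
Proof.
have c : continuous (fun s : bal_perm => (s i : discrete_topology int)).
  move=> s.
  apply: (@continuous_comp _ _ _ (fun s : bal_perm => (bal_perm_val s))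
    (fun t : perm_int => (t i : discrete_topology int))).
    exact: initial_continuous.
  apply: (@continuous_comp _ _ _ (fun s : perm_int => (set_val s : {ptws int -> discrete_topology int}))
    (fun t : {ptws int -> discrete_topology int} => (t i : discrete_topology int))).
    exact: initial_continuous.
  exact: (@proj_continuous _ (fun _ : int => discrete_topology int) i).
move/continuousP: c => /(_ [set v]); apply.
exact: discrete_open.
Qed.

Definition cylinder (c : seq (int * int)) : set bal_perm :=
  [set s | forall p, p \in c -> s p.1 = p.2].

(** The filter generated by agreement with [s] on finite sets converges to [s]
    pointwise, so it contains every neighbourhood of [s]. *)
Lemma nbhs_cylinder (U : set bal_perm) (s : bal_perm) : open U -> U s ->
  exists c, cylinder c s /\ cylinder c `<=` U.
Proof.
move=> [V [W oW <-] <-] Ws.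
pose F : set_system {ptws int -> discrete_topology int} :=
  filter_from [set: seq int] (fun S => [set f | forall i, i \in S -> f i = s i]).
have FF : Filter F.
  apply: filter_from_filter; first by exists [::].
  move=> S S' _ _; exists (S ++ S') => // f fE; split=> i iS; apply: fE;
  by rewrite mem_cat iS ?orbT.
have : {ptws, F --> (s : int -> discrete_topology int)}.
  apply/(@pointwise_cvgP (discrete_topology int) (discrete_topology int)).
  move=> i A /= /nbhs_singleton As; exists [:: i] => // f fE.
  by rewrite /= fE// inE.
move=> /(_ W); case.
  exact: open_nbhs_nbhs.
move=> S _ SW; exists [seq (i, s i) | i <- S]; split.
  by move=> p /mapP[i _ ->].
move=> t tc; apply: SW => i iS; apply: (tc (i, s i)).
by apply/mapP; exists i.
Qed.

Lemma open_bigcup_cylinder (U : set bal_perm) : open U ->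
  U = \bigcup_(c in [set c | cylinder c `<=` U]) cylinder c.
Proof.
move=> oU; apply/seteqP; split=> [s Us|s [c cU cs]]; last exact: cU.
by have [c [cs cU]] := nbhs_cylinder oU Us; exists c.
Qed.

Lemma coord_measurable (i : int) :
  measurable_fibers (fun s : bal_perm => s i).
Proof. by move=> v; apply: sub_sigma_algebra; exact: coord_open. Qed.

(** Every open set is a union of cylinders, and there are countably many of
    them, so the coordinates generate the Borel sigma-algebra. *)
Lemma measurable_to_bal_perm d (T : measurableType d) (D : set T)
    (f : T -> bal_perm) : measurable D ->
  (forall i v, measurable (D `&` [set x | f x i = v])) -> measurable_fun D f.
Proof.
move=> mD mf; apply: (@measurability _ _ _ _ _ _ (@open bal_perm)) => //.
move=> _ [U oU <-]; rewrite (open_bigcup_cylinder oU) preimage_bigcup setI_bigcupr.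
rewrite bigcup_mkcond; apply: countable_bigcupT_measurable => // c.
case: ifPn => // _; elim: c => [|p c IH].
  rewrite (_ : _ `&` _ = D)//; apply/seteqP; split=> x; [by case|by split].
rewrite (_ : _ `&` _ = (D `&` [set x | f x p.1 = p.2]) `&` (D `&` f @^-1` cylinder c)).
  exact: measurableI.
apply/seteqP; split=> x /=.
  by move=> [Dx cx]; do 2!split=> //; [|move=> r rc]; apply: cx; rewrite inE ?eqxx ?rc ?orbT.
by move=> [[Dx px] [_ cx]]; split=> // r; rewrite inE => /predU1P[->//|/cx].
Qed.

(** * Cardinals of finite sets *)

Definition ncard (T : choiceType) (A : set T) : nat := #|` fset_set A|%fset.

Section ncard_theory.
Context (T : choiceType).
Implicit Types (A B : set T) (x : T).

Lemma ncard_setU1 A x : finite_set A -> ~ A x -> ncard (x |` A) = (ncard A).+1.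
Proof.
move=> fA nAx; rewrite /ncard fset_setU1// cardfsU1 in_fset_set//.
by rewrite memNset.
Qed.

Lemma ncard_sub A B : finite_set B -> A `<=` B -> (ncard A <= ncard B)%N.
Proof.
move=> fB AB; have fA := sub_finite_set AB fB.
by apply: fsubset_leq_card; rewrite -fset_set_sub.
Qed.

Lemma ncard_image (U : choiceType) (f : T -> U) A : finite_set A ->
  (forall x y, A x -> A y -> f x = f y -> x = y) -> ncard (f @` A) = ncard A.
Proof.
move=> fA fI; rewrite /ncard fset_set_image// card_in_imfset// => x y.
by rewrite /= !in_fset_set// => /set_mem Ax /set_mem Ay; exact: fI.
Qed.

Lemma ncard_eqII A n : (A #= `I_n)%card <-> finite_set A /\ ncard A = n.
Proof.
split=> [An|[/finite_setP[m Am] <-]].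
  by split; [apply/finite_setP; exists n|exact: card_fset_set].
by rewrite /ncard (card_fset_set Am).
Qed.

End ncard_theory.

Lemma int_two_way_ind (P : int -> Prop) :
  P 0 -> (forall n, P n <-> P (n + 1)) -> forall n, P n.
Proof.
move=> P0 PS; elim=> [//|n|n] IH.
  by rewrite -addn1 PoszD; exact: (PS _).1.
by apply/(PS _).2; rewrite -addn1 PoszD opprD subrK.
Qed.

Lemma balancedE (s : perm_int) : balanced s <->
  [/\ finite_set (up_crossings s), finite_set (down_crossings s) &
      ncard (up_crossings s) = ncard (down_crossings s)].
Proof.
rewrite balancedP; split=> [[n [/ncard_eqII[fu un] /ncard_eqII[fd dn]]]|[fu fd ud]].
  by rewrite un dn.
by exists (ncard (up_crossings s)); split; apply/ncard_eqII.
Qed.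

Lemma perm_inj (s : perm_int) : injective s.
Proof. exact: can_inj (perm_invK s). Qed.

(** * Displacement of a balanced permutation *)

Section displacement.
Variable s : perm_int.

Let U (a b : int) : set int := [set j | a < j /\ s j <= b].
Let L (a b : int) : set int := [set j | j <= a /\ b < s j].

(** Finiteness belongs to the invariant: the cardinal of an infinite set has the
    default value 0, for which the equation would be meaningless. *)
Let excess (A B : set int) (n : int) : Prop :=
  [/\ finite_set A, finite_set B & (ncard A)%:Z = (ncard B)%:Z + n].

Let excess_l A B x n : ~ A x -> excess (x |` A) B (n + 1) <-> excess A B n.
Proof.
move=> nAx; rewrite /excess finite_setU; split=> [[[_ fA] fB]|[fA fB]].
  by rewrite ncard_setU1// => ?; split=> //; lia.
by move=> ?; rewrite ncard_setU1//; split=> //; last lia.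
Qed.

Let excess_r A B x n : ~ B x -> excess A B (n + 1) <-> excess A (x |` B) n.
Proof.
move=> nBx; rewrite /excess finite_setU; split=> [[fA fB]|[fA [_ fB]]].
  by move=> ?; rewrite ncard_setU1//; split=> //; lia.
by rewrite ncard_setU1// => ?; split=> //; last lia.
Qed.

(** Raising [a] to [a + 1] affects the position [a + 1] only: it leaves [U] when
    [s (a + 1) <= b] and enters [L] otherwise. *)
Let excess_stepa a b n :
  excess (U a b) (L a b) (n + 1) <-> excess (U (a + 1) b) (L (a + 1) b) n.
Proof.
have [sb|sb] := lerP (s (a + 1)) b.
  have -> : U a b = (a + 1) |` U (a + 1) b.
    apply/seteqP; split=> j /=; rewrite /U /=.
      by have [->|] := eqVneq j (a + 1); [left|right; lia].
    by case=> [->|]; [split; lia|lia].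
  have -> : L a b = L (a + 1) b.
    apply/seteqP; split=> j /=; rewrite /L /=; first lia.
    by have [->|] := eqVneq j (a + 1); lia.
  by apply: excess_l; rewrite /U /=; lia.
have -> : L (a + 1) b = (a + 1) |` L a b.
  apply/seteqP; split=> j /=; rewrite /L /=.
    by have [->|] := eqVneq j (a + 1); [left|right; lia].
  by case=> [->|]; [split; lia|lia].
have -> : U (a + 1) b = U a b.
  apply/seteqP; split=> j /=; rewrite /U /=; first lia.
  by have [->|] := eqVneq j (a + 1); lia.
by apply: excess_r; rewrite /L /=; lia.
Qed.

(** Raising [b] to [b + 1] affects only the position whose value is [b + 1]. *)
Let excess_stepb a b n :
  excess (U a b) (L a b) n <-> excess (U a (b + 1)) (L a (b + 1)) (n + 1).
Proof.
pose x := perm_inv_fun s (b + 1).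
have sx : s x = b + 1 by exact: perm_invKV.
have sxj j : s j = b + 1 -> j = x by move=> sj; apply: (@perm_inj s); rewrite sj.
have sjx j : j != x -> s j != b + 1 by apply: contra_neq => /sxj.
have [xa|xa] := lerP x a.
  have -> : L a b = x |` L a (b + 1).
    apply/seteqP; split=> j /=; rewrite /L /=.
      by have [->|/sjx] := eqVneq j x; [left|right; lia].
    by case=> [->|]; [split; lia|lia].
  have -> : U a (b + 1) = U a b.
    apply/seteqP; split=> j /=; rewrite /U /=; last lia.
    by have [->|/sjx] := eqVneq j x; lia.
  by apply: iff_sym; apply: excess_r; rewrite /L /=; lia.
have -> : U a (b + 1) = x |` U a b.
  apply/seteqP; split=> j /=; rewrite /U /=.
    by have [->|/sjx] := eqVneq j x; [left|right; lia].
  by case=> [->|]; [split; lia|lia].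
have -> : L a (b + 1) = L a b.
  apply/seteqP; split=> j /=; rewrite /L /=; first lia.
  by have [->|/sjx] := eqVneq j x; lia.
by apply: iff_sym; apply: excess_l; rewrite /U /=; lia.
Qed.

Definition left_inversions_at (t : int -> int) (i : int) : set int :=
  [set j | j < i /\ t i < t j].

(** The cut at [a = i], [b = s i - 1] has [inversions_at s i] on one side and
    [i] together with [left_inversions_at s i] on the other. *)
Lemma balanced_displacement i : balanced s ->
  finite_set (left_inversions_at s i) /\
  s i = i + (inv_count s i)%:Z - (ncard (left_inversions_at s i))%:Z.
Proof.
move=> /balancedE[fu fd ud].
have E00 : excess (U 0 0) (L 0 0) 0.
  have -> : U 0 0 = up_crossings s.
    by apply/seteqP; split=> j; rewrite /U /up_crossings /=; lia.
  have -> : L 0 0 = down_crossings s.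
    by apply/seteqP; split=> j; rewrite /L /down_crossings /=; lia.
  by split=> //; rewrite ud addr0.
have Ea a : excess (U a 0) (L a 0) (- a).
  elim/int_two_way_ind: a => [//|a]; rewrite -excess_stepa.
  by rewrite opprD subrK.
have Eab a b : excess (U a b) (L a b) (b - a).
  elim/int_two_way_ind: b => [|b]; first by rewrite sub0r; exact: Ea.
  by rewrite addrAC; exact: excess_stepb.
have := Eab i (s i - 1).
have -> : U i (s i - 1) = inversions_at s i.
  by apply/seteqP; split=> j; rewrite /U /inversions_at /=; lia.
have -> : L i (s i - 1) = i |` left_inversions_at s i.
  apply/seteqP; split=> j; rewrite /L /left_inversions_at /=.
    have [->|/eqP ji] := eqVneq j i; first by left.
    have sji : s j <> s i by move/perm_inj.
    by right; lia.
  by case=> [->|]; [split; lia|lia].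
move=> [_ fL]; rewrite -/(inv_count s i) ncard_setU1 /left_inversions_at /=; last first.
- lia.
- by move: fL; rewrite finite_setU => -[].
move: fL; rewrite finite_setU => -[_ fL] E; split=> //.
rewrite /inv_count -/(ncard _); lia.
Qed.

End displacement.

(** * Recovering a permutation from its code *)

Section decoding.
Implicit Type x : int -> nat.

(** When [x] is the code of [s], this is the number of [l > i + n] such that
    [s l < s i]. *)
Fixpoint smaller_beyond x (i : int) (n : nat) : nat :=
  if n is m.+1 then
    (smaller_beyond x i m - (x (i + m.+1%:Z)%R < smaller_beyond x i m)%N)%N
  else x i.

(** When [x] is the code of [s], this tells whether [s (i + n + 1) < s i]. *)
Definition coded_inversion x (i : int) (n : nat) : bool :=
  (x (i + n.+1%:Z)%R < smaller_beyond x i n)%N.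

(** This is [i + r_i - l_i], where [l_i] counts the inversions of [i] with earlier
    positions as predicted by the code. *)
Definition perm_of_code x (i : int) : int :=
  i + (x i)%:Z - (ncard [set n | coded_inversion x (i - n.+1%:Z) n])%:Z.

(** Put [j = i + n + 1]. If [s j < s i], every [l > j] with [s l < s j], and also
    [j] itself, is among the [l > i + n] with [s l < s i], so [r_j] is smaller than
    their number; if [s i < s j], these [l] are all inverted with [j], so [r_j] is at
    least their number. *)
Lemma inv_count_smaller_beyond (s : perm_int) i n : balanced s ->
  smaller_beyond (inv_count s) i n = ncard [set l | i + n%:Z < l /\ s l < s i] /\
  coded_inversion (inv_count s) i n = (s (i + n.+1%:Z) < s i).
Proof.
move=> bs; have fI j := finite_inversions_at j bs.
pose S m : set int := [set l | i + m%:Z < l /\ s l < s i].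
have fS m : finite_set (S m).
  by apply: sub_finite_set (fI i) => l; rewrite /S /inversions_at /=; lia.
have step m : smaller_beyond (inv_count s) i m = ncard (S m) ->
    coded_inversion (inv_count s) i m = (s (i + m.+1%:Z) < s i).
  rewrite /coded_inversion => ->; set j := i + m.+1%:Z.
  have [sji|sij] := ltP (s j) (s i).
    rewrite /inv_count -/(ncard _) -(@ncard_setU1 _ _ j) //; last first.
      by rewrite /inversions_at /=; lia.
    apply: ncard_sub => // l [->|]; rewrite /S /inversions_at /=; first lia.
    by move: @j sji => /= j sji; lia.
  apply/negbTE; rewrite -leqNgt; apply: ncard_sub => // l.
  rewrite /S /inversions_at /=; have [->|] := eqVneq l j; first lia.
  by move: @j sij => /= j sij; lia.
suff R : smaller_beyond (inv_count s) i n = ncard (S n) by split; [|exact: step].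
elim: n => [|n IH].
  rewrite /= /inv_count -/(ncard _); congr ncard.
  by apply/seteqP; split=> l; rewrite /S /inversions_at /=; lia.
rewrite /= -[(_ < _)%N]/(coded_inversion (inv_count s) i n) step// IH.
set j := i + n.+1%:Z; have [sji|sij] := ltP (s j) (s i).
  have -> : S n = j |` S n.+1.
    apply/seteqP; split=> l; rewrite /S /=.
      by have [->|] := eqVneq l j; [left|right; lia].
    by case=> [->|]; [split; lia|lia].
  rewrite ncard_setU1//; first by rewrite subSS subn0.
  by rewrite /S /=; lia.
rewrite subn0; congr ncard; apply/seteqP; split=> l; rewrite /S /=; last lia.
by have [->|] := eqVneq l j; lia.
Qed.

Lemma inv_countK (s : perm_int) : balanced s -> perm_of_code (inv_count s) =1 s.
Proof.
move=> bs i; have [fL ->] := balanced_displacement i bs.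
rewrite /perm_of_code; congr (_ - (_)%:Z).
pose g (j : int) := (`|i - j|%N.-1)%N.
rewrite -(@ncard_image _ _ g)//; last first.
  by move=> a b; rewrite /left_inversions_at /g /=; lia.
congr ncard; apply/seteqP; split=> n /=.
  rewrite (inv_count_smaller_beyond _ _ bs).2 subrK => H.
  exists (i - n.+1%:Z); last by rewrite /g; lia.
  by rewrite /left_inversions_at /=; split=> //; lia.
move=> [j [ji sij] <-]; rewrite (inv_count_smaller_beyond _ _ bs).2 subrK.
by rewrite (_ : i - _ = j)// /g; lia.
Qed.

End decoding.

(** * Measurability of the coding map and of its inverse *)

Section measurable_codes.
Context d (T : measurableType d).

Lemma measurable_inv_count (f : T -> int -> int) :
  (forall i, measurable_fibers (fun x => f x i)) ->
  forall i, measurable_fibers (fun x => inv_count (f x) i).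
Proof.
move=> mf i; apply: measurable_card_set => j.
exact: (measurable_fibers_pred2 (fun a b : int => (i < j) && (a < b))
  (mf j) (mf i)).
Qed.

Lemma measurable_to_int_prod (f : T -> int_prod nat) :
  (forall i, measurable_fibers (fun x => f x i)) -> measurable_fun setT f.
Proof.
move=> mf; have := @measurability _ _ T (int_prod nat) setT f (@cylinders1 _ nat).
apply=> //.
move=> _ [_ [i _ [B _ <-]] <-]; rewrite !setTI.
exact: (measurable_fibers_pred B (mf i)).
Qed.

End measurable_codes.

Lemma measurable_inv_count_map : measurable_fun setT inv_count_map.
Proof.
apply: measurable_to_int_prod => i.
exact: (@measurable_inv_count _ bal_perm _ coord_measurable).
Qed.

Lemma measurable_int_prod_coord (i : int) :
  measurable_fibers (fun x : int_prod nat => x i).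
Proof.
move=> v; apply: sub_sigma_algebra; exists i => //.
by exists [set v] => //; rewrite setTI.
Qed.

Lemma measurable_perm_of_code (i : int) :
  measurable_fibers (fun x : int_prod nat => perm_of_code x i).
Proof.
have mX := measurable_int_prod_coord.
have mrem j n : measurable_fibers (fun x : int_prod nat => smaller_beyond x j n).
  elim: n => [|n IH] /=; first exact: mX.
  exact: (measurable_fibers_comp2 (fun a b : nat => (a - (b < a))%N) IH (mX _)).
have mcnt : measurable_fibers (fun x : int_prod nat =>
    ncard [set n | coded_inversion x (i - n.+1%:Z) n]).
  apply: measurable_card_set => n.
  exact: (measurable_fibers_pred2 (fun a b : nat => (a < b)%N) (mX _) (mrem _ _)).
exact: (measurable_fibers_comp2 (fun a b : nat => i + a%:Z - b%:Z) (mX i) mcnt).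
Qed.

Lemma inv_count_mapK (s : bal_perm) : perm_of_code (inv_count_map s) = s.
Proof. by apply/funext/inv_countK/bal_permP. Qed.

Lemma inv_count_map_inj : injective inv_count_map.
Proof.
move=> s t st; apply: val_inj; apply: perm_funP => i.
by rewrite -[LHS](congr1 (fun f => f i) (inv_count_mapK s)) st inv_count_mapK.
Qed.

(** The conditions on the right say that the decoded function is injective and
    surjective, that it is balanced, and that its code is [x]; each of them
    involves countably many coordinates. *)
Lemma range_inv_count_map : range inv_count_map =
  [set x | ((forall i j, i != j -> perm_of_code x i <> perm_of_code x j) /\
            (forall v, exists i, perm_of_code x i = v)) /\
           ((finite_set (up_crossings (perm_of_code x)) /\
             finite_set (down_crossings (perm_of_code x))) /\
            ncard (up_crossings (perm_of_code x)) =
              ncard (down_crossings (perm_of_code x))) /\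
           (forall i, inv_count (perm_of_code x) i = x i)].
Proof.
apply/seteqP; split=> [_ [s _ <-]|x].
  rewrite /= !inv_count_mapK.
  have [fu fd ud] := (balancedE s).1 (bal_permP s).
  do 2?split=> //.
    by move=> i j /eqP ij /perm_inj.
  by move=> v; exists (perm_inv_fun s v); exact: perm_invKV.
move=> [[inj surj] [[[fu fd] ud] rx]].
pose g v := sval (cid (surj v)).
have gK : cancel g (perm_of_code x) by move=> v; rewrite /g; case: cid.
have Kg : cancel (perm_of_code x) g.
  by move=> i; apply/eqP/negP => /negP /inj; rewrite gK.
pose s := mk_perm (Bijective Kg gK).
have bs : balanced s by apply/balancedE; split.
by exists (mk_bal_perm bs) => //; apply/funext => i; exact: rx.
Qed.

Lemma measurable_range_inv_count_map : measurable (range inv_count_map).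
Proof.
have mD := measurable_perm_of_code.
rewrite range_inv_count_map; apply: measurable_cond_and; last apply: measurable_cond_and.
- apply: measurable_cond_and.
    apply: measurable_cond_forall => i; apply: measurable_cond_forall => j.
    exact: (measurable_fibers_pred2 (fun a b : int => i != j -> a <> b) (mD i) (mD j)).
  by apply: measurable_cond_forall => v; apply: measurable_cond_exists => i; exact: mD.
- have mu j : measurable [set x : int_prod nat | up_crossings (perm_of_code x) j].
    exact: (measurable_fibers_pred (fun a : int => (1 <= j) && (a <= 0)) (mD j)).
  have md j : measurable [set x : int_prod nat | down_crossings (perm_of_code x) j].
    exact: (measurable_fibers_pred (fun a : int => (j <= 0) && (1 <= a)) (mD j)).
  apply: measurable_cond_and.
    by apply: measurable_cond_and; exact: measurable_finite_set.
  exact: (measurable_fibers_pred2 (fun a b : nat => a = b)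
    (measurable_card_set mu) (measurable_card_set md)).
- apply: measurable_cond_forall => i.
  exact: (measurable_fibers_pred2 (fun a b : nat => a = b)
    (measurable_inv_count mD i) (measurable_int_prod_coord i)).
Qed.

(** The image of [C] is the preimage of [C] under the inverse of the coding map,
    and the coordinates of this inverse are given by [perm_of_code]. *)
Lemma measurable_image_inv_count_map (C : set bal_perm) :
  measurable C -> measurable (inv_count_map @` C).
Proof.
move=> mC; pose B := range inv_count_map.
pose g (x : int_prod nat) : bal_perm :=
  if pselect (B x) is left Bx then sval (cid2 Bx) else point.
have gK x : B x -> inv_count_map (g x) = x.
  by move=> Bx; rewrite /g; case: pselect => // Bx'; case: cid2.
have mg : measurable_fun B g.
  apply: measurable_to_bal_perm => [|i v]; first exact: measurable_range_inv_count_map.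
  rewrite (_ : _ `&` _ = B `&` [set x | perm_of_code x i = v]).
    by apply: measurableI; [exact: measurable_range_inv_count_map|exact: measurable_perm_of_code].
  have gE x : B x -> g x i = perm_of_code x i.
    by move=> Bx; rewrite -{2}(gK x Bx) inv_count_mapK.
  by apply/seteqP; split=> x [Bx] /= <-; split=> //=; rewrite gE.
rewrite (_ : _ @` C = B `&` g @^-1` C).
  exact: mg measurable_range_inv_count_map _ mC.
apply/seteqP; split=> [_ [s Cs <-]|x [Bx Cx]]; last by exists (g x) => //; exact: gK.
have Bs : B (inv_count_map s) by exists s.
by split=> //=; rewrite (inv_count_map_inj (gK _ Bs)).
Qed.

(** * Action of a transposition on the measure *)

Definition swap_fun (i k j : int) : int :=
  if j == i then k else if j == k then i else j.

Lemma swap_funK i k : involutive (swap_fun i k).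
Proof. by move=> j; rewrite /swap_fun; repeat case: ifPn => /=; lia. Qed.

(** Right multiplication by the transposition [(i k)], [k = i + n + 1], written as
    [(i k) = (i i+1) (i+1 k) (i i+1)] so that exchangeability applies factor by
    factor. *)
Fixpoint mulr_swap (i : int) (n : nat) (s : bal_perm) : bal_perm :=
  if n is m.+1 then mulr_transp i (mulr_swap (i + 1) m (mulr_transp i s))
  else mulr_transp i s.

Lemma mulr_transpE i s j : mulr_transp i s j = s (swap_fun i (i + 1) j).
Proof. by []. Qed.

Lemma mulr_swapE i n s j : mulr_swap i n s j = s (swap_fun i (i + n.+1%:Z) j).
Proof.
elim: n i s j => [//|n IH] i s j.
rewrite [mulr_swap _ _ _]/= mulr_transpE IH mulr_transpE; congr (s _).
by rewrite /swap_fun; repeat case: ifPn => /=; lia.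
Qed.

Lemma measurable_mulr_transp i : measurable_fun setT (mulr_transp i).
Proof.
apply: measurable_to_bal_perm => // j v; rewrite setTI.
exact: (coord_measurable (swap_fun i (i + 1) j) v).
Qed.

Lemma measurable_mulr_swap i n : measurable_fun setT (mulr_swap i n).
Proof.
apply: measurable_to_bal_perm => // j v; rewrite setTI.
under eq_set do rewrite mulr_swapE.
exact: coord_measurable.
Qed.

Section exchange.
Context (R : realType) (q : R) (q0 : 0 < q) (Q : probability bal_perm R).
Hypothesis exQ : right_q_exchangeable q Q.

Lemma measure_mulr_transp_asc i A : measurable A ->
  A `<=` [set s : bal_perm | s i < s (i + 1)] ->
  Q (mulr_transp i @^-1` A) = (q%:E * Q A)%E.
Proof.
move=> mA sA; have [_ _ _ /(_ A mA)] := exQ i; rewrite /pushforward => ->.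
rewrite -integral_cst//; apply: eq_integral => s /set_mem /sA /= si.
by rewrite gtr0_sg ?subr_gt0.
Qed.

Lemma measure_mulr_transp_desc i A : measurable A ->
  A `<=` [set s : bal_perm | s (i + 1) < s i] ->
  Q (mulr_transp i @^-1` A) = (q^-1%:E * Q A)%E.
Proof.
move=> mA sA; have [_ _ _ /(_ A mA)] := exQ i; rewrite /pushforward => ->.
rewrite -integral_cst//; apply: eq_integral => s /set_mem /sA /= si.
by rewrite ltr0_sg ?subr_lt0.
Qed.

Let measurable_lt i j : measurable [set s : bal_perm | s i < s j].
Proof.
exact: (measurable_fibers_pred2 (fun a b : int => a < b)
  (coord_measurable i) (coord_measurable j)).
Qed.

(** Since [s (i + 1)] is outside the interval between [s i] and [s k], it is either
    below or above both. In the decomposition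
    [(i k) = (i i+1) (i+1 k) (i i+1)] one outer factor then contributes [q] and the
    other [q^-1], and the inner one contributes [q] by induction. *)
Lemma measure_mulr_swap n i A : measurable A ->
  A `<=` [set s : bal_perm | s i < s (i + n.+1%:Z) /\
    forall l, i < l < i + n.+1%:Z -> ~ (s i < s l < s (i + n.+1%:Z))] ->
  Q (mulr_swap i n @^-1` A) = (q%:E * Q A)%E.
Proof.
elim: n i A => [|n IH] i A mA sA.
  by apply: measure_mulr_transp_asc => // s /sA[].
pose T := mulr_transp i; pose S := mulr_swap (i + 1) n.
have mT B : measurable B -> measurable (T @^-1` B).
  by move=> mB; rewrite -[_ @^-1` _]setTI; exact: measurable_mulr_transp.
have mS B : measurable B -> measurable (S @^-1` B).
  by move=> mB; rewrite -[_ @^-1` _]setTI; exact: measurable_mulr_swap.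
have jE : i + 1 + n.+1%:Z = i + n.+2%:Z by lia.
have Ti (s : bal_perm) : T s i = s (i + 1).
  by rewrite /T mulr_transpE /swap_fun eqxx.
have Ti1 (s : bal_perm) : T s (i + 1) = s i.
  by rewrite /T mulr_transpE /swap_fun; case: ifPn; rewrite ?eqxx; lia.
have Tl (s : bal_perm) l : i + 1 < l -> T s l = s l.
  by move=> il; rewrite /T mulr_transpE /swap_fun !ifF//; lia.
have Si (s : bal_perm) : S s i = s i.
  by rewrite /S mulr_swapE /swap_fun !ifF//; lia.
have Si1 (s : bal_perm) : S s (i + 1) = s (i + n.+2%:Z).
  by rewrite /S mulr_swapE /swap_fun eqxx jE.
have Sj (s : bal_perm) : S s (i + n.+2%:Z) = s (i + 1).
  by rewrite /S mulr_swapE /swap_fun jE eqxx ifF//; lia.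
have HS B : measurable B -> B `<=` A -> Q (S @^-1` (T @^-1` B)) =
    (q%:E * Q (T @^-1` B))%E.
  move=> mB BA; apply: IH; first exact: mT.
  move=> s /BA /sA[]; rewrite jE Ti Tl; last lia.
  move=> lt between; split=> // l il.
  by have := between l; rewrite Tl; last lia; apply; lia.
pose A1 := A `&` [set s : bal_perm | s (i + 1) < s i].
pose A2 := A `&` [set s : bal_perm | s i < s (i + 1)].
have mA1 : measurable A1 by exact: measurableI.
have mA2 : measurable A2 by exact: measurableI.
have AE : A = A1 `|` A2.
  apply/seteqP; split=> s; last by case=> -[].
  by move=> As; have [si|si|] := ltgtP ((s : bal_perm) i) ((s : bal_perm) (i + 1));
    [right|left|move/perm_inj; lia].
have between1 (s : bal_perm) : A2 s -> s (i + n.+2%:Z) < s (i + 1).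
  move=> [/sA[lt /(_ (i + 1))] /= btw ltr]; rewrite ltNge; apply/negP => le.
  apply: btw; first lia.
  rewrite ltr /= lt_neqAle le andbT; apply/eqP => /perm_inj; lia.
have E1 : Q (T @^-1` (S @^-1` (T @^-1` A1))) = (q%:E * Q A1)%E.
  rewrite measure_mulr_transp_asc; last first.
  - by move=> s [/sA[+ _] /=]; rewrite Ti Ti1 Tl ?Si ?Si1 ?Sj//; lia.
  - by apply: mS; apply: mT.
  rewrite HS//; last by move=> s [].
  rewrite measure_mulr_transp_desc//; last by move=> s [].
  by rewrite !muleA -!EFinM mulfK ?gt_eqF.
have E2 : Q (T @^-1` (S @^-1` (T @^-1` A2))) = (q%:E * Q A2)%E.
  rewrite measure_mulr_transp_desc; last first.
  - by move=> s /between1 /=; rewrite Ti1 Tl ?Si ?Si1 ?Sj//; lia.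
  - by apply: mS; apply: mT.
  rewrite HS//; last by move=> s [].
  rewrite measure_mulr_transp_asc//; last by move=> s [].
  by rewrite !muleA -!EFinM mulVf ?gt_eqF ?mul1r.
have disj : A1 `&` A2 = set0.
  by rewrite -subset0 => s [[_ /= +] [_ /=]]; lia.
have -> : mulr_swap i n.+1 @^-1` A =
    T @^-1` (S @^-1` (T @^-1` A1)) `|` T @^-1` (S @^-1` (T @^-1` A2)).
  by rewrite {1}AE.
rewrite measureU; last 3 first.
- exact: (mT _ (mS _ (mT _ mA1))).
- exact: (mT _ (mS _ (mT _ mA2))).
- by rewrite -!preimage_setI disj !preimage_set0.
transitivity (q%:E * Q A1 + q%:E * Q A2)%E; first by congr (_ + _)%E.
by rewrite AE measureU// ge0_muleDr.
Qed.

End exchange.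

(** * Exchanging neighbouring values *)

Definition next_above (s : int -> int) (i j : int) : Prop :=
  [/\ i < j, s i < s j & forall l, i < l -> ~ (s i < s l < s j)].

Definition next_below (s : int -> int) (i j : int) : Prop :=
  [/\ i < j, s j < s i & forall l, i < l -> ~ (s j < s l < s i)].

Lemma next_above_uniq (s : perm_int) i j k :
  next_above s i j -> next_above s i k -> j = k.
Proof.
move=> [ij sj jP] [ik sk kP]; apply: (@perm_inj s).
by have := jP k ik; have := kP j ij; lia.
Qed.

Lemma next_below_uniq (s : perm_int) i j k :
  next_below s i j -> next_below s i k -> j = k.
Proof.
move=> [ij sj jP] [ik sk kP]; apply: (@perm_inj s).
by have := jP k ik; have := kP j ij; lia.
Qed.

Lemma ex_argmin (P : int -> Prop) (f : int -> nat) :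
  (exists j, P j) -> exists j, P j /\ forall l, P l -> (f j <= f l)%N.
Proof.
move=> [j0 Pj0]; have ex : exists n, `[< exists j, P j /\ f j = n >].
  by exists (f j0); apply/asboolP; exists j0.
case: (ex_minnP ex) => n /asboolP[j [Pj <-]] nmin.
by exists j; split=> // l Pl; apply: nmin; apply/asboolP; exists l.
Qed.

(** Only finitely many [j > i] have [s j < s i], so some [j > i] has
    [s i < s j]; the least such value is next above. *)
Lemma ex_next_above (s : perm_int) i : balanced s -> exists j, next_above s i j.
Proof.
move=> bs; have [j] : exists j, i < j /\ s i < s j.
  apply: contrapT => no.
  have : finite_set [set n : nat | inversions_at s i (i + n.+1%:Z)].
    apply: (@sub_finite_set _ _ ((fun j => (`|j - i|%N.-1)%N) @` inversions_at s i)).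
      by move=> n /= ?; exists (i + n.+1%:Z) => //; lia.
    exact/finite_image/finite_inversions_at.
  rewrite (_ : [set n | _] = setT); first exact: infinite_nat.
  apply/seteqP; split=> n // _; rewrite /inversions_at /=.
  apply/andP; split; first lia.
  have : s (i + n.+1%:Z) <> s i by move/perm_inj; lia.
  by case: (ltP (s i) (s (i + n.+1%:Z))) => H; [exfalso; apply: no; exists (i + n.+1%:Z); lia|lia].
move=> jP; have [k [[ik sk] kmin]] :=
  @ex_argmin (fun j => i < j /\ s i < s j) (fun j => `|s j - s i|%N) (ex_intro _ j jP).
exists k; split=> // l il sl.
by have := kmin l; lia.
Qed.

Lemma ex_next_below (s : perm_int) i : (0 < inv_count s i)%N ->
  exists j, next_below s i j.
Proof.
move=> r0; have [j] : exists j, i < j /\ s j < s i.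
  apply: contrapT => no; move: r0; rewrite /inv_count.
  rewrite (_ : inversions_at s i = set0) ?fset_set0 ?cardfs0//.
  by rewrite -subset0 => j /andP[ij sj]; apply: no; exists j.
move=> jP; have [k [[ik sk] kmin]] :=
  @ex_argmin (fun j => i < j /\ s j < s i) (fun j => `|s i - s j|%N) (ex_intro _ j jP).
exists k; split=> // l il sl.
by have := kmin l; lia.
Qed.

Section swap.
Variables (s t : perm_int) (i k : int).
Hypothesis bs : balanced s.
Hypothesis tE : forall j, t j = s (swap_fun i k j).

Lemma next_swap : next_below s i k <-> next_above t i k.
Proof.
have [ik|] := ltP i k; last by move=> ki; split=> -[]; lia.
have ti : t i = s k by rewrite tE /swap_fun eqxx.
have tk : t k = s i by rewrite tE /swap_fun eqxx ifF//; lia.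
have tl l : i < l -> l != k -> t l = s l.
  by move=> il lk; rewrite tE /swap_fun !ifF//; lia.
rewrite /next_below /next_above ti tk.
split=> -[_ lt btw]; split=> // l il; have := btw l il;
  (have [->|lk] := eqVneq l k; [rewrite ?tk; lia|rewrite (tl l)//]).
Qed.

(** No value to the right of [i] separates [s i] from [s k], so each position
    [l > i] compares in the same way with both, and a position [l < i] sees the same
    set of values on its right. Only the comparison of [i] with [k] changes. *)
Lemma inv_count_swap : next_below s i k ->
  inv_count s i = (inv_count t i).+1 /\
  forall l, l != i -> inv_count s l = inv_count t l.
Proof.
move=> [ik ski btw].
have ti : t i = s k by rewrite tE /swap_fun eqxx.
have tk : t k = s i by rewrite tE /swap_fun eqxx ifF//; lia.
have tl l : l != i -> l != k -> t l = s l.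
  by move=> il lk; rewrite tE /swap_fun (negbTE il) (negbTE lk).
have sneq a b : a != b -> s a <> s b by move=> /eqP ab /perm_inj.
have fI l : finite_set (inversions_at s l) by exact: finite_inversions_at.
split.
  have E : inversions_at s i = k |` inversions_at t i.
    apply/seteqP; split=> j; rewrite /inversions_at /= ti.
      have [->|jk] := eqVneq j k; first by left.
      move=> /andP[ij sj]; right; rewrite ij /= tl//; last lia.
      by have := btw j ij; have := sneq _ _ jk; lia.
    have [->|jk] := eqVneq j k; first by move=> _; lia.
    case=> [/eqP|]; first by rewrite (negbTE jk).
    by case: (ltP i j) => //= ij; rewrite tl//; lia.
  have fT : finite_set (inversions_at t i).
    by have := fI i; rewrite E finite_setU => -[].
  rewrite /inv_count -!/(ncard _) E ncard_setU1//.
  by rewrite /inversions_at /= tk ti; lia.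
move=> l li; have [lti|gti] := ltP l i.
  have tll : t l = s l by rewrite tl//; lia.
  rewrite /inv_count -!/(ncard _) -(@ncard_image _ _ (swap_fun i k))//; last first.
    by move=> a b _ _; exact: (inv_inj (@swap_funK i k)).
  congr ncard; apply/seteqP; split=> j /=.
    move=> [m /andP[lm sm] <-]; rewrite /inversions_at /= tE swap_funK tll sm.
    by rewrite andbT /swap_fun; repeat case: ifPn => /=; lia.
  rewrite /inversions_at /= tE tll => /andP[lj sj].
  exists (swap_fun i k j); last exact: swap_funK.
  apply/andP; split=> //.
  by rewrite /swap_fun; repeat case: ifPn => /=; lia.
have il : i < l by lia.
rewrite /inv_count; congr (#|` fset_set _|%fset).
have {}tl m : i < m -> m != k -> t m = s m by move=> im; apply: tl; lia.
have tlt j : l < j -> (t j < t l) = (s j < s l).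
  move=> lj; have ij : i < j by lia.
  have [jk|jk] := eqVneq j k.
    have := btw l il; have := @sneq l i; rewrite jk tk tl//; lia.
  rewrite (tl j)//; have [lk|lk] := eqVneq l k; last by rewrite tl.
  by have := btw j ij; have := sneq _ _ jk; rewrite lk tk; lia.
by apply/seteqP; split=> j; rewrite /inversions_at /=; case: (ltP l j) => //= /tlt ->.
Qed.

End swap.

(** * Independence and geometric law of the code *)

Lemma measurable_next_above i j :
  measurable [set s : bal_perm | next_above s i j].
Proof.
rewrite (_ : [set s : bal_perm | _] = [set s : bal_perm |
    (i < j /\ s i < s j) /\ (forall l, i < l -> ~ (s i < s l < s j))]); last first.
  by apply/seteqP; split=> s [] // [].
have mc := coord_measurable.
apply: measurable_cond_and.
  exact: (measurable_fibers_pred2 (fun a b : int => i < j /\ a < b) (mc i) (mc j)).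
apply: measurable_cond_forall => l.
exact: (measurable_fibers_pred2 (fun (a : int) (p : int * int) =>
  i < l -> ~ (p.1 < a < p.2)) (mc l)
  (measurable_fibers_comp2 pair (mc i) (mc j))).
Qed.

Section independence.
Context (R : realType) (q : R) (q01 : 0 < q < 1) (Q : probability bal_perm R).
Hypothesis exQ : right_q_exchangeable q Q.

Let q0 : 0 < q. Proof. by case/andP: q01. Qed.

(** Independence of the coordinate [i] from the others is tested on an arbitrary
    event [D] that the others determine. *)
Section one_coordinate.
Variables (i : int) (D : set (int_prod nat)).
Hypothesis mD : measurable D.
Hypothesis D_indep : forall x y : int_prod nat,
  (forall l, l != i -> x l = y l) -> D x -> D y.

Let E (k : nat) : set bal_perm :=
  [set s : bal_perm | inv_count s i = k] `&` inv_count_map @^-1` D.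

Let mE k : measurable (E k).
Proof.
apply: measurableI.
  exact: (@measurable_inv_count _ bal_perm _ coord_measurable).
by rewrite -[_ @^-1` _]setTI; exact: measurable_inv_count_map.
Qed.

Let U n : set bal_perm := [set s : bal_perm | next_above s i (i + n.+1%:Z)].

Let next_shift (s : bal_perm) j : i < j -> exists n : nat, j = i + n.+1%:Z.
Proof. by move=> ij; exists (`|j - i|%N.-1)%N; lia. Qed.

Let preimage_swap k n : mulr_swap i n @^-1` (U n `&` E k) =
  [set s : bal_perm | next_below s i (i + n.+1%:Z)] `&` E k.+1.
Proof.
apply/seteqP; split=> s.
  move=> [Us [rk Dk]].
  have nb := (next_swap (mulr_swapE i n s)).2 Us.
  have [ri rl] := inv_count_swap (bal_permP s) (mulr_swapE i n s) nb.
  split=> //; split; first by rewrite /= ri rk.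
  apply: D_indep Dk => l li; exact/esym/rl.
move=> [nb [rk Dk]].
have [ri rl] := inv_count_swap (bal_permP s) (mulr_swapE i n s) nb.
split; first exact: (next_swap (mulr_swapE i n s)).1 nb.
split; first by move: rk; rewrite /= ri => -[].
by apply: D_indep Dk => l li; exact: rl.
Qed.

(** Split [E k] according to the position of the value next above [s i], and
    [E k.+1] according to the position of the value next below it; the
    transposition exchanges the corresponding pieces. *)
Let measure_E_succ k : Q (E k.+1) = (q%:E * Q (E k))%E.
Proof.
have mUE n : measurable (U n `&` E k).
  by apply: measurableI; [exact: measurable_next_above|exact: mE].
have -> : E k = \bigcup_n (U n `&` E k).
  apply/seteqP; split=> [s Es|s [n _ []]//].
  have [j sj] := ex_next_above i (bal_permP s).
  have [n jE] : exists n : nat, j = i + n.+1%:Z by case: sj => + _ _; exact: next_shift.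
  by exists n => //; split=> //; rewrite /U /= -jE.
have -> : E k.+1 = \bigcup_n (mulr_swap i n @^-1` (U n `&` E k)).
  under eq_bigcupr do rewrite preimage_swap.
  apply/seteqP; split=> [s Es|s [n _ []]//].
  have [|j sj] := @ex_next_below s i; first by case: Es => /= ->.
  have [n jE] : exists n : nat, j = i + n.+1%:Z by case: sj => + _ _; exact: next_shift.
  by exists n => //; split=> //=; rewrite -jE.
rewrite !measure_bigcup//=; last first.
- move=> m n _ _ [s []]; rewrite !preimage_swap => -[nm _] [nn _].
  by have := next_below_uniq nm nn; lia.
- by move=> n _; rewrite -[_ @^-1` _]setTI; exact: measurable_mulr_swap.
- move=> m n _ _ [s [[nm _] [nn _]]].
  by have := next_above_uniq nm nn; lia.
rewrite -nneseriesZl//; apply: eq_eseriesr => n _.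
apply: measure_mulr_swap => // s [[_ lt btw] _]; split=> // l /andP[il _].
exact: btw.
Qed.

Let trivIset_E (B : set nat) : trivIset B E.
Proof. by move=> m n _ _ [s [[<- _] [<- _]]]. Qed.

Let bigcup_E (B : set nat) : \bigcup_(k in B) E k =
  [set s : bal_perm | B (inv_count s i)] `&` inv_count_map @^-1` D.
Proof.
apply/seteqP; split=> [s [k Bk [rk Ds]]|s [Bs Ds]].
  by split=> //; rewrite /= rk.
by exists (inv_count s i).
Qed.

(** The events [E k] partition the event [D] and their measures form a geometric
    progression, so the sum of the series determines the first term. *)
Let measure_E k : Q (E k) = (((1 - q) * q ^+ k)%:E * Q (inv_count_map @^-1` D))%E.
Proof.
pose a := fine (Q (E 0)).
have Qa n : Q (E n) = (a * q ^+ n)%:E.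
  elim: n => [|n IH]; first by rewrite expr0 mulr1 /a fineK// fin_num_measure.
  by rewrite measure_E_succ IH -EFinM mulrCA -exprS.
have -> : Q (inv_count_map @^-1` D) = (a / (1 - q))%:E.
  have -> : inv_count_map @^-1` D = \bigcup_k E k by rewrite bigcup_E setTI.
  rewrite measure_bigcup//.
  apply/cvg_lim => //.
  rewrite (_ : (fun n => _) = EFin \o series (geometric a q)); last first.
    apply/funext => n /=; rewrite /series /= -sumEFin.
    by rewrite big_mkcond; apply: eq_bigr => m _; rewrite in_setT Qa.
  apply: cvg_EFin; first by near=> n.
  by apply: cvg_geometric_series; rewrite gtr0_norm//; case/andP: q01.
rewrite Qa -EFinM; congr (_%:E).
rewrite [RHS]mulrAC [_ * (a / _)]mulrCA mulfV ?mulr1//.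
by rewrite subr_eq0 gt_eqF//; case/andP: q01.
Unshelve. all: by end_near. Qed.

Lemma inv_count_geometric (B : set nat) :
  Q ([set s : bal_perm | B (inv_count s i)] `&` inv_count_map @^-1` D) =
  (geometric_prob q B * Q (inv_count_map @^-1` D))%E.
Proof.
rewrite -bigcup_E measure_bigcup//.
pose QD := fine (Q (inv_count_map @^-1` D)).
have mD' : measurable (inv_count_map @^-1` D).
  by rewrite -[_ @^-1` _]setTI; exact: measurable_inv_count_map.
have QDE : Q (inv_count_map @^-1` D) = QD%:E by rewrite /QD fineK// fin_num_measure.
have g0 k : (0 <= ((1 - q) * q ^+ k)%:E :> \bar R)%E.
  by rewrite lee_fin mulr_ge0 ?subr_ge0 ?exprn_ge0//; case/andP: q01 => /ltW ? /ltW.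
rewrite QDE muleC /geometric_prob q01.
transitivity (\sum_(k <oo | k \in B) (QD%:E * ((1 - q) * q ^+ k)%:E))%E.
  by apply: eq_eseriesr => k _; rewrite muleC -QDE; exact: measure_E.
rewrite nneseriesZl//; congr (_ * _)%E.
rewrite nneseries_esum//; congr (esum _ _).
by apply/seteqP; split=> k /=; [exact: set_mem|exact: mem_set].
Qed.

End one_coordinate.

(** Coordinates are split off one at a time: the event on the remaining ones does
    not look at the coordinate removed. *)
Lemma inv_count_cylinder (r : seq int) (B : int -> set nat) : uniq r ->
  Q [set s : bal_perm | forall i, i \in r -> B i (inv_count s i)] =
  (\prod_(i <- r) geometric_prob q (B i))%E.
Proof.
elim: r => [_|i r IH /= /andP[ir /IH {}IH]].
  rewrite big_nil -(probability_setT Q); congr (Q _).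
  by apply/seteqP; split.
pose D : set (int_prod nat) := [set x | forall l, l \in r -> B l (x l)].
rewrite big_cons -IH -[X in (_ * Q X)%E]/(inv_count_map @^-1` D).
rewrite -(@inv_count_geometric i D).
- congr (Q _); apply/seteqP; split=> s /=.
    by move=> H; split=> [|l lr]; apply: H; rewrite inE ?eqxx// lr orbT.
  by move=> [Bi H] l; rewrite inE => /predU1P[->//|]; exact: H.
- apply: measurable_cond_forall => l.
  exact: (measurable_fibers_pred (fun k => l \in r -> B l k)
    (measurable_int_prod_coord l)).
- move=> x y xy Dx l lr; rewrite -xy; first exact: Dx.
  by apply: contraNneq ir => <-.
Qed.

End independence.

(** * The isomorphism *)

Definition finite_cylinders : set (set (int_prod nat)) :=
  [set A | exists (J : {fset int}) (B : int -> set nat),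
    A = [set x : int_prod nat | forall i, i \in J -> B i (x i)]].

Lemma finite_cylinders_setI : setI_closed finite_cylinders.
Proof.
move=> _ _ [J [B ->]] [K [C ->]]; exists (J `|` K)%fset.
exists (fun i => [set n | (i \in J -> B i n) /\ (i \in K -> C i n)]).
apply/seteqP; split=> x /=; first by move=> [Bx Cx] i _; split=> [/Bx|/Cx].
move=> H; split=> i iX.
  have /H[Bi _] : i \in (J `|` K)%fset by rewrite inE iX.
  exact: Bi.
have /H[_ Ci] : i \in (J `|` K)%fset by rewrite inE iX orbT.
exact: Ci.
Qed.

Lemma measurable_finite_cylinders :
  @measurable _ (int_prod nat) = <<s finite_cylinders >>.
Proof.
apply/seteqP; split.
  apply: smallest_sub; first exact: smallest_sigma_algebra.
  move=> _ [i _ [B _ <-]]; apply: sub_sigma_algebra.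
  exists [fset i]%fset, (fun=> B); rewrite setTI.
  apply/seteqP; split=> x /=; first by move=> Bx j; rewrite inE => /eqP ->.
  by apply; rewrite inE.
apply: smallest_sub; first exact: sigma_algebra_measurable.
move=> _ [J [B ->]]; apply: measurable_cond_forall => i.
exact: (measurable_fibers_pred (fun k => i \in J -> B i k)
  (measurable_int_prod_coord i)).
Qed.

Theorem theorem4p3 (R : realType) (q : R) (q_bounds : 0 < q < 1)
    (Q : probability bal_perm R) (mallowsQ : is_mallows q Q)
    (G : probability (int_prod nat) R)
    (productG : is_product_measure (fun _ : int => geometric_prob q) G) :
  measure_isomorphism Q G inv_count_map.
Proof.
have mpsi := measurable_inv_count_map.
have QG B : measurable B -> pushforward Q inv_count_map B = G B.
  move=> mB.
  pose law : {measure set (int_prod nat) -> \bar R} := pushforward Q inv_count_map.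
  pose Qpsi := law mpsi.
  apply: (@measure_unique _ R _ finite_cylinders (fun=> setT)
    measurable_finite_cylinders finite_cylinders_setI _ _ Qpsi G) => //.
  - move=> _; exists fset0, (fun=> setT); apply/seteqP; split=> x // _ i.
  - by rewrite bigcup_const.
  - move=> _ [J [C ->]]; transitivity (\prod_(i <- J) geometric_prob q (C i))%E.
      exact: (inv_count_cylinder q_bounds mallowsQ.1 C (fset_uniq J)).
    by apply/esym/productG.
  - by move=> _; rewrite /Qpsi /= /pushforward preimage_setT probability_setT ltry.
split=> //; exists setT, (range inv_count_map).
have mT := measurable_range_inv_count_map.
split.
- by split=> //; rewrite setCT measure0.
- split=> //; transitivity (pushforward Q inv_count_map (~` range inv_count_map)).
    by apply/esym/QG/measurableC.
  rewrite /pushforward (_ : _ @^-1` _ = set0) ?measure0//.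
  by rewrite -subset0 => s; apply; exists s.
- split=> [s _|s t _ _|x [s _ <-]]; [by exists s|exact: inv_count_map_inj|by exists s].
- by move=> C mC _; exact: measurable_image_inv_count_map.
- by move=> D mD _; exact: mpsi.
Qed.
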